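(* Let $\alpha\ge 1$ be a stretch parameter and let $\varepsilon\in(0,1)$ be any given constant. Let $T$ be an edge-weighted tree and $K\subseteq V(T)$ a set of terminals, $n=|K|\geq 2$. (1) If $\alpha=2+\varepsilon$, then $O(1)$ trees suffice: there is a non-Steiner tree cover for $K$ of stretch $2+\varepsilon$ and size $O(1)$; the number of trees is $O(\varepsilon^{-2}\log(\varepsilon^{-1}))$. (2) If $\alpha=2$, then $O(\log n)$ trees suffice: there is a non-Steiner tree cover for $K$ of stretch $2$ and size $O(\log n)$. Furthermore, $\Omega(\log n)$ trees are necessary: (for every $n$) there exist a tree and a set of $n$ terminals in it such that every non-Steiner tree cover of stretch $2$ for the terminals has $\Omega(\log n)$ trees. (3) If $\alpha=2-\varepsilon$, then $\Theta(n)$ trees are both necessary and sufficient: there always is a non-Steiner tree cover for $K$ of stretch $2-\varepsilon$ and size $O(n)$, and (for every $n$) there exist a tree and a set of $n$ terminals in it such that every non-Steiner tree cover of stretch $2-\varepsilon$ for the terminals has $\Omega(n)$ trees.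
   Context: Let $T=(V_T,E_T,\omega_T)$ be a finite tree with positive edge weights, $d_T$ its shortest-path metric, and $K\subseteq V_T$ a set of terminals. A collection $\mathcal{T}=\{T_1,\dots,T_\beta\}$ of $\beta$ edge-weighted trees is an $(\alpha,\beta)$-non-Steiner tree cover for $K$ if: (Steiner free) $V(T_i)=K$ for every $i\in[\beta]$; (dominating) $d_{T_i}(x,y)\ge d_T(x,y)$ for every $i\in[\beta]$ and all $x,y\in K$; (low stretch) $\min_{i\in[\beta]}d_{T_i}(x,y)\le\alpha\cdot d_T(x,y)$ for all $x,y\in K$. The parameter $\alpha$ is the stretch and $\beta$ is the size of the cover. In the bound $O(\varepsilon^{-2}\log(\varepsilon^{-1}))$, the logarithm is read as $\max\{1,\log(\varepsilon^{-1})\}$ and the hidden constant is absolute. *)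

(* Defs.v *)
From mathcomp Require Import all_boot all_order all_algebra.
From mathcomp Require Import classical_sets reals exp.

Set Implicit Arguments.
Unset Strict Implicit.
Unset Printing Implicit Defensive.

Import Order.TTheory GRing.Theory Num.Theory.
Local Open Scope ring_scope.

(* Only the values [weight x y] with [adj x y] are meaningful. *)
Record wtree (R : realType) (V : finType) := WTree {
  adj : rel V;
  weight : V -> V -> R;
  adj_sym : symmetric adj;
  adj_irr : irreflexive adj;
  adj_connected : forall x y, connect adj x y;
  (* a [ucycle] of size 2 is a single edge traversed back and forth *)
  adj_acyclic : forall c : seq V, ucycle adj c -> (size c <= 2)%N;
  weight_sym : forall x y, adj x y -> weight x y = weight y x;
  weight_gt0 : forall x y, adj x y -> 0 < weight x y }.

Fixpoint walk_weight (R : realType) (V : finType) (T : wtree R V)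
    (x : V) (p : seq V) : R :=
  if p is z :: q then weight T x z + walk_weight T z q else 0.

(* Shortest-path metric. By connectedness and positivity the set of walk
   weights is nonempty and bounded below by 0, so [inf] is not a junk value. *)
Definition dist (R : realType) (V : finType) (T : wtree R V) (x y : V) : R :=
  inf [set r | exists p : seq V,
    [/\ path (adj T) x p, last x p = y & r = walk_weight T x p]]%classic.

(* Steiner-freeness is enforced by the type of the trees: their vertex set is
   exactly the subtype of terminals. The minimum over the trees is at most a
   bound iff some tree meets it, which in particular rules out an empty cover. *)
Definition non_steiner_tree_cover (R : realType) (V : finType) (T : wtree R V)
    (K : {set V}) (alpha : R) (beta : nat)
    (F : 'I_beta -> wtree R {x : V | x \in K}) : Prop :=
  (forall i x y, dist T (val x) (val y) <= dist (F i) x y) /\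
  (forall x y, exists i, dist (F i) x y <= alpha * dist T (val x) (val y)).

Definition has_cover (R : realType) (V : finType) (T : wtree R V)
    (K : {set V}) (alpha : R) (beta : nat) : Prop :=
  exists F : 'I_beta -> wtree R {x : V | x \in K},
    non_steiner_tree_cover T alpha F.

(* Main.v *)
Require Import Defs.
From mathcomp Require Import all_boot all_order all_algebra.
From mathcomp Require Import classical_sets reals exp.
From mathcomp Require Import zify ring lra.

Import Order.TTheory GRing.Theory Num.Theory.
Local Open Scope ring_scope.

Set Implicit Arguments.
Unset Strict Implicit.
Unset Printing Implicit Defensive.

(** A tree metric satisfies the four-point condition, so with respect to a root
    the depth of the lowest common ancestor (half the Gromov product) is an
    ultrametric similarity. This is all that the upper bounds use. Any spanning
    tree on the terminals whose edges weigh their distance dominates the metric.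
    If a point [v] lies on the path from [x] to [y] and the center [c] is at least
    as close to [v] as [x] and [y] are, then
      d(x,c) + d(c,y) <= d(x,v) + d(v,y) + 2 d(c,v) <= 2 d(x,y).
    - Stretch 2: take [v] to be a centroid and recurse on the components of its
      complement; each of the O(log n) levels is a forest of stars.
    - Stretch 2 + eps: at each scale D cut the rooted tree at the depths that are
      multiples of a large constant times D, shifted by one of O(1/eps) offsets; a
      pair at distance about D has its lowest common ancestor just below some
      cut, and the highest point of each piece serves as its center. Scales
      separated by a factor at least of order 1/eps are stacked in a single tree
      by contracting every piece to its center.
    - Stretch below 2: the n stars; they are even exact.
    For the lower bounds, hang long edges off a path, so that the metric on the
    leaves is nearly uniform. Stretch below 2 forces every pair to be an edge of
    some tree. Stretch 2 forces, up to edges and grandparents, a common parent at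
    distance comparable to |x - y|; giving the pair the weight 1/|x - y|, each tree
    covers O(n) while the total is at least n ln n. *)

(** * The metric of a weighted tree *)

Section Distance.
Variables (R : realType) (V : finType) (T : wtree R V).
Implicit Types x y z u : V.

Lemma walk_weight_ge0 x p : path (adj T) x p -> 0 <= walk_weight T x p.
Proof.
elim: p x => //= z p IH x /andP[axz pp].
by rewrite addr_ge0 ?IH // ltW // weight_gt0.
Qed.

Lemma dist_le_walk x p : path (adj T) x p -> dist T x (last x p) <= walk_weight T x p.
Proof.
move=> pp; apply: ge_inf; last by exists p.
by exists 0 => _ [q [pq _ ->]]; exact: walk_weight_ge0.
Qed.

Lemma has_walk x y :
  ([set r | exists p, [/\ path (adj T) x p, last x p = y & r = walk_weight T x p]]
     !=set0)%classic.
Proof.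
by have /connectP[p pp ->] := adj_connected T x y; exists (walk_weight T x p), p.
Qed.

Lemma dist_lt_walk x y (b : R) : dist T x y < b ->
  exists p, [/\ path (adj T) x p, last x p = y & walk_weight T x p < b].
Proof.
move=> db; have bd : 0 < b - dist T x y by rewrite subr_gt0.
have hi : has_inf [set r | exists p, [/\ path (adj T) x p, last x p = y
    & r = walk_weight T x p]]%classic.
  split; first exact: has_walk.
  by exists 0 => _ [q [pq _ ->]]; exact: walk_weight_ge0.
have [_ [p [pp lp ->]]] := inf_adherent bd hi.
by rewrite -/(dist T x y) addrC subrK => h; exists p.
Qed.

Lemma dist_potential (phi : V -> R) x y :
  (forall z u, adj T z u -> phi z <= weight T z u + phi u) ->
  phi x - phi y <= dist T x y.
Proof.
move=> lip; apply: lb_le_inf; first exact: has_walk.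
move=> _ [p [pp <- ->]]; elim: p x pp => [|z p IH] x /=; first by rewrite subrr.
by case/andP=> axz /IH; have := lip _ _ axz; lra.
Qed.

Lemma distxx x : dist T x x = 0.
Proof.
apply/eqP; rewrite eq_le (@dist_le_walk x [::]) //=.
have /= := @dist_potential (fun=> 0) x x; rewrite subrr; apply => z u azu.
by rewrite addr0 ltW // weight_gt0.
Qed.

Lemma dist_adj x y : adj T x y -> dist T x y <= weight T x y.
Proof. by move=> a; have := @dist_le_walk x [:: y]; rewrite /= a addr0; apply. Qed.

Lemma dist_step x y z : adj T x y -> dist T x z <= weight T x y + dist T y z.
Proof.
move=> a; rewrite -lerBlDl; apply: lb_le_inf; first exact: has_walk.
move=> _ [p [pp <- ->]]; rewrite lerBlDl.
by apply: (@dist_le_walk x (y :: p)); rewrite /= a.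
Qed.

Lemma dist_triangle y x z : dist T x z <= dist T x y + dist T y z.
Proof.
rewrite -lerBlDr; apply: (@dist_potential (dist T ^~ z)) => u v; exact: dist_step.
Qed.

Lemma dist_sym x y : dist T x y = dist T y x.
Proof.
suff le a b : dist T a b <= dist T b a by apply/eqP; rewrite eq_le !le.
have := @dist_potential (dist T a) b a; rewrite distxx subr0; apply => z u azu.
apply: le_trans (dist_triangle u a z) _; rewrite addrC lerD2r weight_sym //.
by apply: dist_adj; rewrite adj_sym.
Qed.

Lemma dist_ge_metric (d : V -> V -> R) :
  (forall x, d x x = 0) -> (forall x y z, d x z <= d x y + d y z) ->
  (forall x y, adj T x y -> d x y <= weight T x y) ->
  forall x y, d x y <= dist T x y.
Proof.
move=> d0 dtri dw x y; have := @dist_potential (d ^~ y) x y; rewrite d0 subr0.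
by apply=> z u /dw dzu; apply: le_trans (dtri z u y) _; rewrite lerD2r.
Qed.

Lemma dist_ge0 x y : 0 <= dist T x y.
Proof.
by apply: (@dist_ge_metric (fun _ _ => 0)) => // *; rewrite ?addr0 // ltW // weight_gt0.
Qed.

Lemma dist_gt0 x y : x != y -> 0 < dist T x y.
Proof.
move=> nxy; have [e e0 he] : exists2 e : R, 0 < e & forall x y, adj T x y -> e <= weight T x y.
  have : forall s : seq (V * V), exists2 e : R, 0 < e &
      forall c, c \in s -> adj T c.1 c.2 -> e <= weight T c.1 c.2.
    elim=> [|c s [e e0 he]]; first by exists 1.
    have [a|na] := boolP (adj T c.1 c.2); last first.
      exists e => // c'; rewrite inE => /orP[/eqP->|]; last exact: he.
      by rewrite (negPf na).
    exists (Num.min e (weight T c.1 c.2)); first by rewrite lt_min e0 weight_gt0.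
    move=> c'; rewrite inE ge_min => /orP[/eqP-> _|/he h /h->//].
    by rewrite lexx orbT.
  move=> /(_ (enum {: V * V})) [e e0 he]; exists e => // a b.
  by apply: (he (a, b)); rewrite mem_enum.
apply: (lt_le_trans e0).
have := @dist_ge_metric (fun a b => if a == b then 0 else e) _ _ _ x y.
rewrite (negPf nxy); apply => [a|a b c|a b /he h]; first by rewrite eqxx.
  have [->|nab] := eqVneq a b; first by rewrite add0r.
  by case: (a == c); case: (b == c) => /=; lra.
by case: ifP => // _; exact: ltW (lt_le_trans e0 h).
Qed.

End Distance.

Section Elimination.
Variables (R : realType) (V : finType) (T : wtree R V).
Implicit Types (x y z u : V) (S : {set V}).

(* The first vertex of a longest simple path in [S] has all its [S]-neighbours
   on the path, and a second one would close a cycle. *)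
Lemma exists_leaf S : S != finset.set0 -> exists2 x, x \in S &
  forall y z, y \in S -> z \in S -> adj T x y -> adj T x z -> y = z.
Proof.
case/set0Pn=> x0 x0S.
pose P n := [exists c : n.-tuple V,
  if tval c is x :: p then [&& path (adj T) x p, uniq c & all (mem S) c] else false].
have exP : exists n, P n.
  by exists 1%N; apply/existsP; exists [tuple x0]; rewrite /= x0S.
have bP n : P n -> (n <= #|V|)%N.
  case/existsP=> -[[//|x p] /= sc] /and3P[_ u _].
  by have /card_uniqP e : uniq (x :: p) := u; rewrite -(eqP sc) -[(size p).+1]e max_card.
case: (ex_maxnP exP bP) => n /existsP[[[//|x p] sc]] /= /and3P[pp u aS] maxn.
exists x; first by case/andP: aS.
have inp y : y \in S -> adj T x y -> y \in p.
  move=> yS axy; apply/negPn/negP => nyp.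
  have nyx : y != x by apply/eqP => yx; rewrite yx adj_irr in axy.
  suff /maxn : P n.+1 by rewrite ltnn.
  have sc' : size [:: y, x & p] == n.+1 by rewrite /= eqSS.
  apply/existsP; exists (Tuple sc'); rewrite /= -[adj T y x]adj_sym axy pp /= yS aS.
  by rewrite inE (negPf nyx) (negPf nyp) u /=.
suff first y : y \in S -> adj T x y -> index y p = 0%N.
  move=> y z yS zS axy axz.
  by rewrite -(nth_index x (inp _ yS axy)) -(nth_index x (inp _ zS axz)) !first.
move=> yS axy; have yp := inp _ yS axy.
case: (splitPr yp) pp u => p1 p2; rewrite -cat_rcons cat_path => /andP[pp _] u.
rewrite cat_rcons index_cat; move: u; rewrite /= cat_uniq rcons_uniq => /and3P[xp /andP[nyp1 u1] _].
rewrite (negPf nyp1) /= eqxx addn0.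
have := @adj_acyclic _ _ T (x :: rcons p1 y); rewrite /ucycle /= rcons_path pp last_rcons.
rewrite adj_sym axy /= rcons_uniq nyp1 u1 /= size_rcons.
have -> : x \notin rcons p1 y by apply: contra xp; rewrite mem_cat => ->.
by move=> /(_ isT); lia.
Qed.

Lemma elimination_order : exists rk : V -> nat, injective rk /\
  forall x y z, adj T x y -> adj T x z -> (rk x < rk y)%N -> (rk x < rk z)%N -> y = z.
Proof.
suff [rk [inj up]] : exists rk : V -> nat, {in [set: V]%SET &, injective rk} /\
  {in [set: V]%SET & &, forall x y z, adj T x y -> adj T x z ->
     (rk x < rk y)%N -> (rk x < rk z)%N -> y = z}.
  by exists rk; split=> [x y|x y z]; [apply: inj|apply: up]; rewrite !inE.
move: {2}#|_| (leqnn #|[set: V]|%SET) => n; elim: n [set: V]%SET => [|n IH] S.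
  rewrite leqn0 cards_eq0 => /eqP->; exists (fun=> 0%N).
  by split=> [x|x]; rewrite inE.
have [->|/exists_leaf[x xS lf]] := eqVneq S finset.set0.
  by move=> _; exists (fun=> 0%N); split=> [x|x]; rewrite inE.
rewrite (finset.cardsD1 x) xS ltnS => /IH[rk [inj up]].
exists (fun y => if y == x then 0%N else (rk y).+1); split.
  move=> y z yS zS; have [->|ny] := eqVneq y x; have [->|nz] := eqVneq z x => //.
  by case=> /inj; apply; rewrite !inE ?ny ?nz.
move=> y z u yS zS uS; have [->|ny] := eqVneq y x; first by move=> ? ? _ _; exact: lf.
have [//|nz] := eqVneq z x; have [//|nu] := eqVneq u x.
by move=> a1 a2; rewrite !ltnS; apply: up; rewrite // !inE ?ny ?nz ?nu.
Qed.

Lemma exists_parent : exists (rk : V -> nat) (p : V -> V), injective rk /\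
  (forall x, p x != x -> adj T x (p x) /\ (rk x < rk (p x))%N) /\
  (forall x y, adj T x y -> p x = y \/ p y = x).
Proof.
have [rk [inj up]] := elimination_order.
pose p x := odflt x [pick y | adj T x y && (rk x < rk y)%N].
exists rk, p; split=> //; split.
  by move=> x; rewrite /p; case: pickP => [y /andP[]|_ /eqP].
have main x y : adj T x y -> (rk x < rk y)%N -> p x = y.
  rewrite /p => a l; case: pickP => [z /andP[a' l']|/(_ y)]; first exact: up a' a l' l.
  by rewrite a l.
move=> x y a; have [l|l|/inj e] := ltngtP (rk x) (rk y).
- by left; exact: main.
- by right; apply: main => //; rewrite adj_sym.
- by rewrite e adj_irr in a.
Qed.

End Elimination.

Section FourPoint.
Variables (R : realType) (V : finType) (T : wtree R V).
Local Notation d := (dist T).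

(* Only the edge from [x] to [p x] leaves the set of descendants of [x]. *)
Lemma dist_parent (rk : V -> nat) (p : V -> V) x y : injective rk ->
  (forall x, p x != x -> adj T x (p x) /\ (rk x < rk (p x))%N) ->
  (forall x y, adj T x y -> p x = y \/ p y = x) ->
  (rk x <= rk y)%N -> x != y ->
  (rk x < rk (p x))%N /\ d x y = weight T x (p x) + d (p x) y.
Proof.
move=> inj hp hadj rxy nxy; pose sub z := fconnect p z x.
have rk_iter n z : (rk z <= rk (iter n p z))%N.
  elim: n => //= n IH; apply: leq_trans IH _.
  by have [->//|/hp[_ /ltnW]] := eqVneq (p (iter n p z)) (iter n p z).
have nsub : ~~ sub y.
  apply/negP => /iter_findex e; move: (rk_iter (findex p y x) y); rewrite e => ryx.
  have /inj e' : rk x = rk y by lia.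
  by rewrite e' eqxx in nxy.
have subp z u : p z = u -> sub u -> sub z.
  by move=> <- h; apply: connect_trans h; exact: fconnect1.
have supp z : sub z -> z != x -> sub (p z).
  move=> /iter_findex; case: (findex p z x) => [/= ->|n]; first by rewrite eqxx.
  by rewrite iterSr => e _; rewrite /sub -e fconnect_iter.
have npx : p x != x.
  apply/eqP => px; have /closed_connect cl : closed (adj T) sub.
    move=> z u /hadj; wlog: z u / p z = u.
      by move=> wl [h|h]; [|symmetry]; apply: wl => //; left.
    move=> e _; apply/idP/idP; rewrite -!topredE /=; last exact: subp.
    move=> sz; have [zx|nz] := eqVneq z x; first by rewrite -e zx px -zx.
    by rewrite -e supp.
  have := cl x y (adj_connected T x y); rewrite -!topredE /= (negPf nsub).
  by rewrite /sub connect0.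
have [apx rpx] := hp _ npx; split=> //.
apply/eqP; rewrite eq_le dist_step //=.
pose phi z := if sub z then weight T x (p x) + d (p x) y - d z x else d z y.
have := @dist_potential _ _ T phi x y.
have subx : sub x by exact: connect0.
rewrite /phi (negPf nsub) subx !distxx !subr0; apply=> z u azu.
have szu : d u x <= weight T z u + d z x.
  by rewrite weight_sym // dist_step // adj_sym.
have := dist_step y azu; case: ifP => sz; case: ifP => su; try lra.
- case/hadj: (azu) => e; last by rewrite (subp _ _ e sz) in su.
  have [zx|nz] := eqVneq z x; last by rewrite -e supp in su.
  by rewrite -e zx distxx; lra.
- case/hadj: (azu) => e; first by rewrite (subp _ _ e su) in sz.
  have [ux|nu] := eqVneq u x; last by rewrite -e supp in sz.
  by rewrite -e ux distxx; have := weight_gt0 apx; have := @dist_step _ _ T _ _ y apx; lra.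
Qed.

(* Induct on ranks: as long as the lowest point differs from the three
   others, moving it to its parent lowers all three sums by the same amount. *)
Theorem four_point a b c e : d a b + d c e <= Num.max (d a c + d b e) (d a e + d b c).
Proof.
have [rk [p [inj [hp hadj]]]] := exists_parent T.
pose P (s t u : R) := (s <= t) || (s <= u).
pose Q x y z t := let s1 := d x y + d z t in let s2 := d x z + d y t in
  let s3 := d x t + d y z in [&& P s1 s2 s3, P s2 s1 s3 & P s3 s1 s2].
rewrite le_max; suff: Q a b c e by case/and3P.
pose M := (\max_x rk x)%N; have leM x : (rk x <= M)%N by exact: leq_bigmax.
have [n] := ubnP (4 * M - (rk a + rk b + rk c + rk e))%N.
elim: n a b c e => // n IH a b c e.
wlog [ab ac ae] : a b c e / [/\ rk a <= rk b, rk a <= rk c & rk a <= rk e]%N.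
  move=> wl hn; have: [|| [&& rk a <= rk b, rk a <= rk c & rk a <= rk e],
            [&& rk b <= rk a, rk b <= rk c & rk b <= rk e],
            [&& rk c <= rk a, rk c <= rk b & rk c <= rk e] |
            [&& rk e <= rk a, rk e <= rk b & rk e <= rk c]]%N by lia.
  case/or4P=> /and3P h.
  - exact: wl.
  - by have := wl b a e c; rewrite /Q /P (dist_sym T b a) (dist_sym T e c) => wl';
      have {wl'} : _ := wl' ltac:(by case: h; split) ltac:(by lia); lra.
  - have := wl c e a b; rewrite /Q /P (dist_sym T c a) (dist_sym T e b) (dist_sym T c b)
      (dist_sym T e a) => wl'.
    by have {wl'} : _ := wl' ltac:(by case: h; split) ltac:(by lia); lra.
  - have := wl e c b a; rewrite /Q /P (dist_sym T e c) (dist_sym T b a) (dist_sym T e b)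
      (dist_sym T c a) (dist_sym T e a) (dist_sym T c b) => wl'.
    by have {wl'} : _ := wl' ltac:(by case: h; split) ltac:(by lia); lra.
move=> hn; rewrite /Q /P.
have [->|nb] := eqVneq a b.
  by rewrite distxx; have := dist_triangle T b c e; rewrite (dist_sym T c b); lra.
have [->|nc] := eqVneq a c.
  by rewrite distxx (dist_sym T b c); have := dist_triangle T c b e; rewrite (dist_sym T b c); lra.
have [->|ne] := eqVneq a e.
  by rewrite distxx (dist_sym T b e) (dist_sym T c e); have := dist_triangle T e b c;
    rewrite (dist_sym T b e); lra.
have [rp eb] := dist_parent inj hp hadj ab nb.
have [_ ec] := dist_parent inj hp hadj ac nc.
have [_ ee] := dist_parent inj hp hadj ae ne.
have : Q (p a) b c e.
  apply: IH; have := leM (p a); have := leM b; have := leM c; have := leM e; lia.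
by rewrite /Q /P eb ec ee; lra.
Qed.

End FourPoint.

(** * Trees built from hierarchical clusterings *)

Section TreeConstruction.
Variables (R : realType) (X : finType) (d : X -> X -> R).
Hypothesis d0 : forall x, d x x = 0.
Hypothesis dsym : forall x y, d x y = d y x.
Hypothesis dpos : forall x y, x != y -> 0 < d x y.
Hypothesis dtri : forall x y z, d x z <= d x y + d y z.

Lemma parent_tree (p : X -> X) (rk : X -> nat) (root : X) :
  (forall x, x != root -> (rk x < rk (p x))%N) ->
  exists T : wtree R X, (forall x y, d x y <= dist T x y) /\
    (forall x, x != root -> dist T x (p x) <= d x (p x)).
Proof.
move=> rkp; pose e x y := (x != root) && (p x == y) || (y != root) && (p y == x).
have esym : symmetric e by move=> x y; rewrite /e orbC.
have eirr : irreflexive e.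
  move=> x; apply/negbTE; rewrite /e orbb; apply/negP => /andP[/rkp].
  by move=> h /eqP px; rewrite px ltnn in h.
have rootc x : connect e x root.
  pose M := (\max_x rk x)%N; have [n] := ubnP (M - rk x)%N.
  elim: n x => // n IH x hx; have [->//|nx] := eqVneq x root.
  apply: (@connect_trans _ _ (p x)); first by apply: connect1; rewrite /e nx eqxx.
  have := rkp _ nx; have lp : (rk (p x) <= M)%N by exact: leq_bigmax.
  by move=> ?; apply: IH; lia.
have econ x y : connect e x y.
  by apply: connect_trans (rootc x) _; rewrite sym_connect_sym.
have up x y : e x y -> (rk x <= rk y)%N -> p x = y.
  by case/orP=> /andP[nz /eqP pz] // le; have := rkp _ nz; rewrite pz; lia.
have eacy (c : seq X) : ucycle e c -> (size c <= 2)%N.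
  case/andP; case: c => // x0 c0; set c := x0 :: c0 => cyc uc.
  have [x xc minx] : exists2 x, x \in c & forall y, y \in c -> (rk x <= rk y)%N.
    case: (@arg_minnP _ x0 (mem c) rk (mem_head _ _)) => x xc h.
    by exists x.
  have [i c' ec] := rot_to xc; rewrite -(rot_cycle i) -(rot_uniq i) ec in cyc uc *.
  have minx' y : y \in x :: c' -> (rk x <= rk y)%N.
    by rewrite -ec mem_rot; exact: minx.
  rewrite -(size_rot i) ec; case: c' {ec} cyc uc minx' => [|y c'] //=.
  rewrite rcons_path => /and3P[exy pyc eyx]; case: c' pyc eyx => // z c' _.
  rewrite esym => eyx /and3P[_ ny _] minx'; case/negP: ny.
  have py : p x = y by apply: up exy (minx' y _); rewrite 2!in_cons eqxx orbT.
  have lz : last z c' \in z :: c' by exact: mem_last.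
  have pz : p x = last z c' by apply: up eyx (minx' _ _); rewrite 2!in_cons lz !orbT.
  by rewrite -py pz.
have wpos x y : e x y -> 0 < d x y.
  by move=> h; apply: dpos; apply: contraTneq h => ->; rewrite eirr.
pose T := WTree esym eirr econ eacy (fun x y _ => dsym x y) wpos.
exists T; split; first exact: dist_ge_metric.
by move=> x nx; apply: (@dist_adj _ _ T); rewrite /= /e nx eqxx.
Qed.

(* [rp l] maps a point to its representative at level [l]. A point is attached
   to its next representative at the level at which it stops representing itself. *)
Lemma hierarchy_tree (rp : nat -> X -> X) (L : nat) (root : X) :
  (forall x, rp 0 x = x) ->
  (forall i l x, (i <= l)%N -> rp i (rp l x) = rp l x) ->
  (forall l x y, rp l x = rp l y -> rp l.+1 x = rp l.+1 y) ->
  (forall x, rp L x = root) ->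
  exists T : wtree R X, (forall x y, d x y <= dist T x y) /\
    (forall l x, (l < L)%N ->
       dist T (rp l x) (rp l.+1 x) <= d (rp l x) (rp l.+1 x)).
Proof.
move=> rp0 nest coh top; pose moves z l := rp l.+1 z != z.
pose rk z := find (moves z) (iota 0 L); pose p z := rp (rk z).+1 z.
have rk_le z : (rk z <= L)%N by rewrite -[leqRHS](size_iota 0) find_size.
have before z l : (l < rk z)%N -> rp l.+1 z = z.
  move=> h; have := before_find 0%N h; rewrite nth_iota ?(leq_trans h) //.
  by move/negbT; rewrite negbK => /eqP.
have at_rk z : (rk z < L)%N -> rp (rk z).+1 z != z.
  move=> h; have := @nth_find _ 0%N (moves z) (iota 0 L).
  rewrite has_find -/(rk z) size_iota nth_iota // add0n; exact.
have rk_lt z : z != root -> (rk z < L)%N.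
  move=> nz; rewrite ltn_neqAle rk_le andbT; apply: contra nz => /eqP e.
  have [L0|Lpos] := posnP L; first by rewrite -(top z) L0 rp0.
  by have := before z L.-1; rewrite e prednK // leqnn top => ->.
have rk_ge l z : (l <= L)%N -> (forall i, (i < l)%N -> rp i.+1 z = z) -> (l <= rk z)%N.
  move=> lL h; rewrite leqNgt; apply/negP => lt.
  by have := at_rk z (leq_trans lt lL); rewrite h ?eqxx.
have [|T [dom hT]] := @parent_tree p rk root.
  by move=> z /rk_lt lt; apply: rk_ge => // i hi; apply: nest.
exists T; split=> // l x lL; set z := rp l x.
have ez : rp l.+1 z = rp l.+1 x by apply: coh; rewrite nest.
have [ezx|nz] := eqVneq (rp l.+1 x) z; first by rewrite ezx distxx d0.
have rkz : rk z = l.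
  apply/eqP; rewrite eqn_leq rk_ge ?(ltnW lL) //; last by move=> i hi; apply: nest.
  by rewrite andbT leqNgt; apply/negP => /before /eqP; rewrite ez; apply/negP.
have nroot : z != root.
  by apply/eqP => e; have := nest l.+1 L x lL; rewrite top -e ez => /eqP; apply/negP.
by have := hT _ nroot; rewrite /p rkz ez.
Qed.

Lemma star_forest_tree (f : X -> X) : X -> (forall x, f (f x) = f x) ->
  exists T : wtree R X, (forall x y, d x y <= dist T x y) /\
    (forall x y, f x = f y -> dist T x y <= d x (f x) + d (f x) y).
Proof.
move=> x0 ff; pose rp l := match l with 0%N => id | 1%N => f | _ => fun=> f x0 end.
have [|||//|T [dom hT]] := @hierarchy_tree rp 2 (f x0).
- by [].
- by case=> [|[|i]] [|[|l]] x //= _; rewrite ff.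
- by case=> [|[|l]] x y //= ->.
exists T; split=> // x y fxy.
have := hT 0%N x isT; have := hT 0%N y isT; rewrite /= -fxy => hy hx.
have := dist_triangle T (f x) x y; rewrite (dist_sym T (f x) y) (dsym (f x) y); lra.
Qed.

End TreeConstruction.

Section Representatives.
Variables (R : realType) (X : finType) (h : X -> R) (E : nat -> rel X).
Hypothesis E_equiv : forall l, equivalence_rel (E l).

Lemma exists_representatives : exists rp : nat -> X -> X,
  [/\ forall x, rp 0 x = x,
      forall i l x, (i <= l)%N -> rp i (rp l x) = rp l x,
      forall l x y, E l (rp l x) (rp l y) -> rp l.+1 x = rp l.+1 y,
      forall l x, E l (rp l x) (rp l.+1 x) &
      forall l x, h (rp l.+1 x) <= h (rp l x)].
Proof.
have Er l x : E l x x by case: (E_equiv l x x x).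
have El l x y z : E l x y -> E l x z = E l y z by case: (E_equiv l x y z) => _; apply.
pose good l (S : {set X}) z c :=
  [&& c \in S, E l z c & [forall y in S, E l z y ==> (h c <= h y)]].
pose ctr l S z := odflt z [pick c | good l S z c].
pose rp := fix rp l x := if l is l'.+1 then ctr l' [set rp l' y | y : X] (rp l' x) else x.
have good_ex l (S : {set X}) z : z \in S -> exists c, good l S z c.
  move=> zS; pose P := [pred c in S | E l z c]; have Pz : P z by rewrite /= zS Er.
  case: (arg_minP h Pz) => c /andP[cS zc] cmin; exists c; rewrite /good cS zc /=.
  apply/forall_inP => y yS; apply/implyP => zy.
  by have := cmin y; rewrite /= yS zy; apply.
have ctr_good l (S : {set X}) z : z \in S -> good l S z (ctr l S z).
  by move=> zS; have [c gc] := good_ex l S z zS; rewrite /ctr; case: pickP => // /(_ c); rewrite gc.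
have ctr_eq l (S : {set X}) y z : y \in S -> E l y z -> ctr l S y = ctr l S z.
  move=> yS yz; have goodE : good l S y =1 good l S z.
    move=> c; rewrite /good (El _ _ _ c yz); congr [&& _, _ & _].
    by apply: eq_forallb => u; rewrite (El _ _ _ u yz).
  rewrite /ctr (eq_pick goodE); case: pickP => // nog.
  by have [c] := good_ex l S y yS; rewrite goodE nog.
have inS l x : rp l x \in [set rp l y | y : X] by apply: imset_f.
exists rp; split=> //.
- move=> i l; elim: l i => [|l IH] i x; first by rewrite leqn0 => /eqP->.
  have /and3P[/imsetP[y _ ey] Ec _] := ctr_good l _ _ (inS l x).
  have fix_le j : (j <= l)%N -> rp j (rp l.+1 x) = rp l.+1 x.
    by move=> jl; rewrite [rp l.+1 x]ey IH.
  rewrite leq_eqVlt => /orP[/eqP->|]; last by rewrite ltnS; exact: fix_le.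
  rewrite [LHS]/= fix_le //; symmetry; exact: ctr_eq.
- by move=> l x y /=; apply: ctr_eq.
- by move=> l x; have /and3P[_ ->] := ctr_good l _ _ (inS l x).
- move=> l x; have /and3P[_ _ /forall_inP/(_ (rp l x) (inS l x))/implyP] :=
    ctr_good l _ _ (inS l x).
  by apply.
Qed.

End Representatives.

(** * Covers of rooted tree metrics *)

Section RootedMetric.
Variables (R : realType) (X : finType) (d : X -> X -> R) (h : X -> R).
Hypothesis d0 : forall x, d x x = 0.
Hypothesis dsym : forall x y, d x y = d y x.
Hypothesis dpos : forall x y, x != y -> 0 < d x y.
Hypothesis dtri : forall x y z, d x z <= d x y + d y z.
Hypothesis hlip : forall x y, h x <= h y + d x y.
Hypothesis hsum : forall x y, d x y <= h x + h y.
Hypothesis dfour : forall x y z, d x z + h y <= Num.max (d x y + h z) (d y z + h x).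

(* When [h] is the distance to a root, this is the depth of the lowest common ancestor. *)
Definition gromov x y : R := (h x + h y - d x y) / 2.
Local Notation G := gromov.

Lemma gromovxx x : G x x = h x.
Proof. by rewrite /G d0; lra. Qed.

Lemma gromovC x y : G x y = G y x.
Proof. by rewrite /G dsym; lra. Qed.

Lemma gromov_ge0 x y : 0 <= G x y.
Proof. by have := hsum x y; rewrite /G; lra. Qed.

Lemma gromov_le x y : G x y <= h x.
Proof. by have := hlip y x; rewrite /G dsym; lra. Qed.

Lemma gromov_ultra x y z : Num.min (G x y) (G y z) <= G x z.
Proof. by have := dfour x y z; rewrite le_max ge_min /G; lra. Qed.

Lemma height_ge0 x : 0 <= h x.
Proof. by rewrite -gromovxx gromov_ge0. Qed.

(* Cutting the rooted tree at the depths [(k M - t) q]: [slab] is the index of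
   the slab containing depth [a], and two points are equivalent when they and
   their lowest common ancestor lie in the same slab. *)
Definition slab (q : R) (M t : nat) (a : R) : nat := ((Num.trunc (a / q) + t) %/ M)%N.

Definition same_slab q M t x y : bool :=
  (slab q M t (h x) == slab q M t (h y)) && (slab q M t (h x) == slab q M t (G x y)).

Lemma slab_le (q : R) M t a b : 0 < q -> a <= b -> (slab q M t a <= slab q M t b)%N.
Proof.
move=> q0 ab; apply: leq_div2r; rewrite leq_add2r; apply: le_truncn.
by rewrite ler_pM2r ?invr_gt0.
Qed.

Lemma same_slab_equiv q M t : 0 < q -> equivalence_rel (same_slab q M t).
Proof.
move=> q0; apply/equivalence_relP; split.
  by move=> x; rewrite /same_slab gromovxx !eqxx.
have tr x y z : same_slab q M t x y -> same_slab q M t y z -> same_slab q M t x z.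
  case/andP=> /eqP xy /eqP gxy /andP[/eqP yz /eqP gyz]; rewrite /same_slab xy yz eqxx /=.
  rewrite eqn_leq; apply/andP; split; last first.
    by rewrite -yz -xy slab_le // gromov_le.
  have := gromov_ultra x y z; rewrite ge_min => /orP[] /(slab_le M t q0).
    by rewrite -gxy xy yz.
  by rewrite -gyz yz.
have sy x y : same_slab q M t x y -> same_slab q M t y x.
  by case/andP=> /eqP xy /eqP gxy; rewrite /same_slab gromovC -gxy xy eqxx.
move=> x y xy z; apply/idP/idP; last exact: tr.
by apply: tr; exact: sy.
Qed.

Lemma trunc_div_itv (q a : R) : 0 < q -> 0 <= a ->
  (Num.trunc (a / q))%:R * q <= a < (Num.trunc (a / q))%:R * q + q.
Proof.
move=> q0 a0; have /truncn_itv/andP[l u] : 0 <= a / q by rewrite divr_ge0 // ltW.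
rewrite -ler_pdivlMr // l /=.
by rewrite -natr1 ltr_pdivrMr // mulrDl mul1r in u.
Qed.

Lemma same_slab_dist (q : R) M t x y : 0 < q -> (0 < M)%N ->
  same_slab q M t x y -> d x y <= 2 * (M%:R * q).
Proof.
move=> q0 M0 /andP[/eqP hxy /eqP hg].
have key a : 0 <= a -> slab q M t a = slab q M t (G x y) -> a <= G x y + M%:R * q.
  move=> a0 e.
  have /andP[lg _] := trunc_div_itv q0 (gromov_ge0 x y).
  have /andP[_ ua] := trunc_div_itv q0 a0.
  have le : (Num.trunc (a / q) + 1 <= Num.trunc (G x y / q) + M)%N.
    move: e; rewrite /slab => e.
    have := ltn_ceil (Num.trunc (a / q) + t) M0.
    have := leq_trunc_div (Num.trunc (G x y / q) + t) M; rewrite -e; lia.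
  by move: le; rewrite -(ler_nat R) -(ler_pM2r q0) !natrD !mulrDl mul1r; lra.
have := key _ (height_ge0 x) hg; have := key _ (height_ge0 y) (etrans (esym hxy) hg).
by rewrite /G; lra.
Qed.

Lemma slab_eq (q : R) M t a g : 0 < q -> (0 < M)%N -> 0 <= a -> 0 <= g ->
  ((Num.trunc (g / q) + t) %% M = 1)%N ->
  g - q <= a -> a + 2 * q <= g + M%:R * q -> slab q M t a = slab q M t g.
Proof.
move=> q0 M0 a0 g0 mod1 ga ag.
have /andP[lg ug] := trunc_div_itv q0 g0; have /andP[la ua] := trunc_div_itv q0 a0.
rewrite /slab; set u := Num.trunc (a / q) in la ua *.
set j := Num.trunc (g / q) in mod1 lg ug *.
have lo : (j < u + 2)%N.
  by rewrite -(ltr_nat R) -(ltr_pM2r q0) natrD mulrDl; lra.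
have hi : (u + 1 < j + M)%N.
  by rewrite -(ltr_nat R) -(ltr_pM2r q0) !natrD !mulrDl; lra.
have := divn_eq (j + t) M; rewrite mod1.
set k := ((j + t) %/ M)%N => e.
have -> : (u + t = k * M + (u + t - k * M))%N by lia.
rewrite divnMDl // divn_small ?addn0 //; lia.
Qed.

Lemma slab_eq_ge (q : R) M t a g : 0 < q -> (0 < M)%N -> 0 <= a -> 0 <= g ->
  ((Num.trunc (g / q) + t) %% M = 1)%N ->
  slab q M t a = slab q M t g -> g - 2 * q <= a.
Proof.
move=> q0 M0 a0 g0 mod1.
have /andP[lg ug] := trunc_div_itv q0 g0; have /andP[la ua] := trunc_div_itv q0 a0.
rewrite /slab; set u := Num.trunc (a / q) in la ua *.
set j := Num.trunc (g / q) in mod1 lg ug *.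
move=> e; have := divn_eq (j + t) M; rewrite mod1 -e => e'.
have lo : (j <= u + 1)%N by have := leq_trunc_div (u + t) M; lia.
by move: lo; rewrite -(ler_nat R) -(ler_pM2r q0) natrD mulrDl; lra.
Qed.

Lemma exists_offset M j : (1 < M)%N -> exists2 t, (t < M)%N & ((j + t) %% M = 1)%N.
Proof.
move=> M1; have M0 : (0 < M)%N by lia.
exists ((M + 1 - j %% M) %% M)%N; first exact: ltn_pmod.
rewrite modnDmr -modnDml subnKC; last by have := ltn_pmod j M0; lia.
by rewrite modnDl modn_small.
Qed.

(* At level [l] the offsets are spaced by [eta * D l] and the slabs are at most
   [3 * D l] high, so a representative moves by at most [6 * D l]; the growth rate
   [1 + 6 / eta] keeps the total drift before level [l] below [eta * D l]. *)
Lemma scale_tree (eta : R) (M t L0 : nat) (D : nat -> R) (x0 : X) :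
  0 < eta -> eta <= 14^-1 -> (t < M)%N ->
  2 / eta + 3 <= M%:R -> M%:R <= 2 / eta + 4 ->
  (forall l, 0 < D l) -> (forall l, (1 + 6 / eta) * D l <= D l.+1) ->
  (forall x, h x < eta * D L0) ->
  exists T : wtree R X, (forall x y, d x y <= dist T x y) /\
    (forall l x y, (l <= L0)%N -> D l <= d x y -> d x y <= 2 * D l ->
      ((Num.trunc (G x y / (eta * D l)) + t) %% M = 1)%N ->
      dist T x y <= (2 + 14 * eta) * d x y).
Proof.
move=> eta0 eta1 tM Mlo Mhi D0 Dgrow hL0.
have M0 : (0 < M)%N by lia.
have q0 l : 0 < eta * D l by rewrite mulr_gt0.
have [rp [rp0 nest merge inE hle]] :=
  exists_representatives h (fun l => same_slab_equiv M t (q0 l)).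
have coh l x y : rp l x = rp l y -> rp l.+1 x = rp l.+1 y.
  by move=> e; apply: merge; rewrite e; case: (same_slab_equiv M t (q0 l) x0 x0 (rp l y)).
have slab0 a : 0 <= a -> a < eta * D L0 -> slab (eta * D L0) M t a = 0%N.
  move=> a0 lt; rewrite /slab divn_small //.
  suff -> : Num.trunc (a / (eta * D L0)) = 0%N by [].
  by apply/truncn0Pn; rewrite -ltNge ltr_pdivrMr // mul1r.
have top x : rp L0.+1 x = rp L0.+1 x0.
  apply: merge; rewrite /same_slab !slab0 ?height_ge0 ?gromov_ge0 //.
  exact: le_lt_trans (gromov_le _ _) (hL0 _).
have [T [dom hT]] := hierarchy_tree d0 dsym dpos dtri rp0 nest coh top.
exists T; split=> //.
have step l x : d (rp l x) (rp l.+1 x) <= 6 * D l.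
  apply: le_trans (same_slab_dist (q0 l) M0 (inE l x)) _.
  have : M%:R * eta <= 3.
    apply: (@le_trans _ _ ((2 / eta + 4) * eta)); first by rewrite ler_pM2r.
    by rewrite mulrDl divfK ?gt_eqF //; lra.
  by move=> /(ler_wpM2r (ltW (D0 l))); lra.
have chain l x : (l <= L0)%N -> dist T x (rp l x) <= eta * D l.
  elim: l => [|l IH] lL; first by rewrite rp0 distxx ltW.
  have := dist_triangle T (rp l x) x (rp l.+1 x); have := IH (ltnW lL).
  have := hT l x (ltnW lL : (l < L0.+1)%N); have := step l x.
  have := ler_wpM2l (ltW eta0) (Dgrow l).
  have -> : eta * ((1 + 6 / eta) * D l) = eta * D l + 6 * D l by field; rewrite gt_eqF.
  lra.
move=> l x y lL Dd dD mod1; set q := eta * D l.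
have q0l : 0 < q := q0 l.
set x' := rp l x; set y' := rp l y; set g := G x y.
have cx : dist T x x' <= q := chain l x lL; have cy : dist T y y' <= q := chain l y lL.
have ex : d x x' <= q := le_trans (dom _ _) cx; have ey : d y y' <= q := le_trans (dom _ _) cy.
have g0 : 0 <= g := gromov_ge0 x y.
have hx' : h x' <= h x + q by have := hlip x' x; rewrite dsym; lra.
have hy' : h y' <= h y + q by have := hlip y' y; rewrite dsym; lra.
have gx : g <= h x := gromov_le x y.
have gy : g <= h y by rewrite /g gromovC gromov_le.
have Gx : h x - q <= G x' x by have := hlip x x'; rewrite /G (dsym x' x); lra.
have Gy : h y - q <= G y y' by have := hlip y y'; rewrite /G; lra.
have Gxy : g - q <= G x' y'.
  have := gromov_ultra x' y y'; have := gromov_ultra x' x y; rewrite !ge_min -/g; lra.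
have hxg : h x <= g + 2 * D l by have := hlip x y; have := hlip y x; rewrite /g /G (dsym y x); lra.
have hyg : h y <= g + 2 * D l by have := hlip x y; have := hlip y x; rewrite /g /G (dsym y x); lra.
have Mq : 2 * D l + 3 * q <= M%:R * q.
  have e : 2 / eta * q = 2 * D l by rewrite /q; field; rewrite gt_eqF.
  by have := ler_wpM2r (ltW q0l) Mlo; rewrite mulrDl e.
have slabx : slab q M t (h x') = slab q M t g.
  by apply: slab_eq; rewrite ?height_ge0 //; have := gromov_le x' y'; lra.
have slaby : slab q M t (h y') = slab q M t g.
  by apply: slab_eq; rewrite ?height_ge0 //; have := gromov_le y' x'; rewrite gromovC; lra.
have slabG : slab q M t (G x' y') = slab q M t g.
  by apply: slab_eq; rewrite ?gromov_ge0 //; have := gromov_le x' y'; lra.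
have ec : rp l.+1 x = rp l.+1 y by apply: merge; rewrite /same_slab slabx slaby slabG eqxx.
set c := rp l.+1 x in ec *.
have near z : rp l.+1 z = c -> slab q M t (h (rp l z)) = slab q M t g ->
    g - 2 * q <= G (rp l z) c.
  move=> ez sz; apply: (@slab_eq_ge q M t) => //; first exact: gromov_ge0.
  by have := inE l z; rewrite ez => /andP[_ /eqP <-].
have := near x erefl slabx; have := near y (esym ec) slaby; rewrite -/x' -/y' => ny nx.
have := hle l x; have := hle l y; rewrite -ec -/c -/x' -/y' => hcy hcx.
have tx := hT l x lL; have ty := hT l y lL; rewrite -ec -/c -/x' -/y' in tx ty.
have p1 := dist_triangle T x' x y; have p2 := dist_triangle T c x' y.
have p3 := dist_triangle T y' c y; rewrite (dist_sym T c y') (dist_sym T y' y) in p3.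
have qd : q <= eta * d x y by rewrite /q ler_pM2l.
move: nx ny; rewrite /G /g /G => nx ny; rewrite /g /G in hx'.
lra.
Qed.

Definition metric_cover (alpha : R) (beta : nat) : Prop :=
  exists F : 'I_beta -> wtree R X, (forall i x y, d x y <= dist (F i) x y) /\
    (forall x y, exists i, dist (F i) x y <= alpha * d x y).

Lemma exists_min_dist : exists2 D0 : R, 0 < D0 & forall x y, x != y -> D0 <= d x y.
Proof.
have [c nc|no] := pickP [pred c : X * X | c.1 != c.2].

  case: (arg_minP (fun c : X * X => d c.1 c.2) nc) => -[a b] /= nab hmin.
  by exists (d a b); [exact: dpos|move=> x y nxy; exact: (hmin (x, y))].
by exists 1 => // x y nxy; have := no (x, y); rewrite /= nxy.
Qed.

Lemma dyadic_scale (a : R) : 1 <= a -> exists n : nat, 2 ^+ n <= a < 2 ^+ n.+1.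
Proof.
move=> a1; have a0 : 0 <= a by lra.
have /andP[lo hi] := truncn_itv a0.
have t0 : (0 < Num.trunc a)%N by rewrite truncn_gt0.
have /andP[l u] := trunc_log_bounds (ltnSn 1) t0.
exists (trunc_log 2 (Num.trunc a)); apply/andP; split.
  by apply: le_trans lo; rewrite -natrX ler_nat.
by apply: lt_le_trans hi _; rewrite -natrX ler_nat.
Qed.

Lemma cover_2_plus (eps : R) : X -> 0 < eps < 1 ->
  exists beta : nat, metric_cover (2 + eps) beta /\ beta%:R <= 2752 * eps ^- 2.
Proof.
move=> x0 /andP[eps0 eps1]; pose eta := eps / 14.
have eta0 : 0 < eta by rewrite divr_gt0.
have eta1 : eta <= 14^-1 by rewrite /eta; lra.
pose M := (Num.trunc (2 / eta) + 4)%N; pose m := (Num.trunc (1 + 6 / eta)).+1.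
have i0 : 0 <= 2 / eta by rewrite divr_ge0 // ltW.
have i1 : 0 <= 1 + 6 / eta by rewrite addr_ge0 // divr_ge0 // ltW.
have /andP[Ml Mu] := truncn_itv i0; have /andP[ml mu] := truncn_itv i1.
have ME : M%:R = (Num.trunc (2 / eta))%:R + 4 :> R by rewrite /M natrD.
have {}Mu : 2 / eta < (Num.trunc (2 / eta))%:R + 1 by rewrite natr1.
have Mlo : 2 / eta + 3 <= M%:R by rewrite ME; lra.
have Mhi : M%:R <= 2 / eta + 4 by rewrite ME; lra.
have mhi : m%:R <= 2 + 6 / eta.
  by have : m%:R = (Num.trunc (1 + 6 / eta))%:R + 1 :> R; rewrite ?natr1 // => ->; lra.
have mlo : 1 + 6 / eta <= 2 ^+ m.
  by apply: le_trans (ltW mu) _; rewrite -natrX ler_nat ltnW // ltn_expl.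
have M0 : (0 < M)%N by rewrite /M addnS.
have [D0 D00 hD0] := exists_min_dist.
pose S := \sum_x h x.
have hS x : h x <= S.
  by rewrite /S (bigD1 x) //= lerDl sumr_ge0 // => y _; exact: (height_ge0).
pose L0 := (Num.trunc (2 * S / (eta * D0))).+1.
have eD0 : 0 < eta * D0 by rewrite mulr_gt0.
have hL0 : 2 * S < eta * D0 * 2 ^+ L0.
  have := truncnS_gt (2 * S / (eta * D0)); rewrite ltr_pdivrMr // => /lt_le_trans; apply.
  rewrite mulrC ler_pM2l //.
  by rewrite -natrX ler_nat ltnW // ltn_expl.
pose D s l := D0 * 2 ^+ (s + m * l) : R.
have Dpos s l : 0 < D s l by rewrite mulr_gt0 // exprn_gt0.
have Dgrow s l : (1 + 6 / eta) * D s l <= D s l.+1.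
  have -> : D s l.+1 = 2 ^+ m * D s l by rewrite /D mulnS addnCA [in LHS]exprD mulrCA.
  by rewrite ler_pM2r.
have DL0 s : forall x, h x < eta * D s L0.
  move=> x; have := hS x; have h0 := height_ge0 x.
  suff : eta * D0 * 2 ^+ L0 <= eta * D s L0 by lra.
  rewrite /D mulrA ler_pM2l // ler_eXn2l ?ltr1n //.
  by apply: leq_trans (leq_addl _ _); rewrite leq_pmull.
have [F hF] := fin_all_exists (fun i : 'I_(m * M) =>
  scale_tree x0 eta0 eta1 (ltn_pmod i M0) Mlo Mhi
    (Dpos (i %/ M)%N) (Dgrow (i %/ M)%N) (DL0 (i %/ M)%N)).
exists (m * M)%N; split.
  exists F; split=> [i|x y]; first by case: (hF i).
  have mM0 : (0 < m * M)%N by rewrite muln_gt0 M0.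
  have [<-|nxy] := eqVneq x y; first by exists (Ordinal mM0); rewrite distxx d0 mulr0.
  have [|a /andP[al au]] := @dyadic_scale (d x y / D0).
    by rewrite ler_pdivlMr // mul1r hD0.
  rewrite ler_pdivlMr // mulrC in al; rewrite ltr_pdivrMr // mulrC exprS mulrCA in au.
  pose s := (a %% m)%N; pose l := (a %/ m)%N.
  have aE : (s + m * l = a)%N by rewrite mulnC addnC -divn_eq.
  have [t tM ht] : exists2 t, (t < M)%N & ((Num.trunc (G x y / (eta * D s l)) + t) %% M = 1)%N.
    by apply: exists_offset; rewrite /M !addnS.
  have iM : (s * M + t < m * M)%N.
    have sm : (s < m)%N by exact: ltn_pmod.
    apply: (@leq_trans (s.+1 * M)); last by rewrite leq_mul2r sm orbT.
    by rewrite mulSn addnC ltn_add2r.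
  have [dom hd] := hF (Ordinal iM); exists (Ordinal iM).
  have -> : 2 + eps = 2 + 14 * eta by rewrite /eta; field.
  rewrite /= divnMDl // (divn_small tM) addn0 modnMDl (modn_small tM) in hd.
  apply: (hd l); rewrite /D ?aE // ?(ltW au) //; last by rewrite -aE.
  apply: leq_trans (leq_div a m) _; rewrite leqNgt; apply/negP => aL.
  have : D0 * 2 ^+ L0 <= D0 * 2 ^+ a by rewrite ler_pM2l // ler_eXn2l ?ltr1n // ltnW.
  have : eta * (D0 * 2 ^+ L0) <= 1 * (D0 * 2 ^+ L0).
    by rewrite ler_pM2r ?mulr_gt0 ?exprn_gt0 //; lra.
  have := hsum x y; have := hS x; have := hS y; lra.
have e0 : eps != 0 by rewrite gt_eqF.
have : m%:R * M%:R <= (2 + 6 / eta) * (2 / eta + 4) by rewrite ler_pM.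
rewrite natrM => /le_trans; apply.
have -> : (2 + 6 / eta) * (2 / eta + 4) = 2352 * eps ^- 2 + 392 * eps^-1 + 8.
  by rewrite /eta; field.
have ie : 1 <= eps^-1 by rewrite invf_ge1 // ltW.
by rewrite -exprVn expr2; nra.
Qed.

(* With [v] the branching point at depth [a] above the minimal heavy ball around
   [x], the relation [e] is "in the same component after deleting [v]", [delta]
   is the distance to [v], and [c] is the terminal nearest to [v]. *)
Lemma centroid (S : {set X}) : (2 <= #|S|)%N ->
  exists (c : X) (e : rel X), [/\ c \in S, equivalence_rel e,
    forall x, x \in S -> (2 * #|[set y in S | e x y]| <= #|S|)%N &
    forall x y, x \in S -> y \in S -> ~~ e x y -> d x c + d c y <= 2 * d x y].
Proof.
move=> S2; have [x0 x0S] : exists x0, x0 \in S by apply/card_gt0P; lia.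
pose ball x a := [set z in S | a <= G x z].
pose heavy := [pred c : X * X | [&& c.1 \in S, c.2 \in S & #|S| < 2 * #|ball c.1 (G c.1 c.2)|]%N].
have [c0 hc0] : exists c, heavy c.
  case: (arg_minP (G x0) x0S) => y yS0 ymin; have yS : y \in S := yS0.
  exists (x0, y); rewrite /= x0S yS /=.
  suff -> : ball x0 (G x0 y) = S by lia.
  by apply/setP => z; rewrite inE andb_idr // => /ymin.
case: (arg_minnP (fun c => #|ball c.1 (G c.1 c.2)|) hc0) => -[x y] /and3P[/= xS yS big bmin].
set a := G x y in big bmin; pose inB z := a <= G x z.
have Gxx z : G z z = h z by exact: gromovxx.
have GC z w : G z w = G w z by exact: gromovC.
have Gle z w : G z w <= h z by exact: gromov_le.
have ultra u v w : (G u v <= G u w) || (G v w <= G u w).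
  by rewrite -ge_min; exact: gromov_ultra.
pose e z w := (inB z == inB w) && [|| ~~ inB z, z == w | a < G z w].
have esym z w : e z w -> e w z.
  case/andP=> /eqP zw; rewrite /e zw eqxx /= => /or3P[->//|/eqP->|]; first by rewrite eqxx orbT.
  by rewrite GC => ->; rewrite !orbT.
have etrans z w u : e z w -> e w u -> e z u.
  case/andP=> /eqP zw h1 /andP[/eqP wu h2]; rewrite /e zw wu eqxx /=.
  rewrite zw wu in h1; rewrite wu in h2; case: (inB u) h1 h2 => //=.
  case/orP=> [/eqP->//|zwa]; case/orP=> [/eqP<-|wua]; first by rewrite zwa orbT.
  by apply/orP; right; have := ultra z w u; lra.
pose delta z := h z + a - 2 * Num.min (G x z) a.
case: (arg_minP delta x0S) => c cS cmin; exists c, e; split=> //.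
- apply/equivalence_relP; split; first by move=> z; rewrite /e !eqxx orbT.
  by move=> z w zw u; apply/idP/idP; apply: etrans => //; exact: esym.
- move=> z zS; have Bcard : (#|[set w in S | ~~ inB w]| + #|ball x a| = #|S|)%N.
    rewrite addnC -[RHS](finset.cardsID [set w | inB w]); congr (_ + _)%N; apply: eq_card => w.
      by rewrite !inE.
    by rewrite !inE andbC.
  have [zB|nzB] := boolP (inB z); last first.
    suff -> : [set w in S | e z w] = [set w in S | ~~ inB w] by lia.
    by apply/setP => w; rewrite !inE /e (negPf nzB) andbT; case: (inB w).
  pose C := [pred w | [&& w \in S, inB w, w != z & a < G z w]].
  have [w0 w0C|noC] := pickP C; last first.
    apply: (@leq_trans 2) => //; rewrite (@leq_pmul2l 2 _ 1) //.
    rewrite -(finset.cards1 z); apply: subset_leq_card; apply/fintype.subsetP => w.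
    rewrite !inE /e zB => /andP[wS /andP[/eqP wB /=]].
    by have := noC w; rewrite /= wS -wB eq_sym; case: eqP => //= _ ->.
  case: (arg_minP (G z) w0C) => w /and4P[wS wB nwz azw] wmin; set b := G z w in azw wmin.
  have bz : b <= h z by exact: Gle.
  rewrite leqNgt; apply/negP => bigz.
  have sub_ball : [set w in S | e z w] \subset ball z b.
    apply/fintype.subsetP => u; rewrite !inE /e zB => /andP[uS /andP[/eqP uB /= zu]]; rewrite uS /=.
    case/orP: zu => [/eqP <-|zu]; first by rewrite Gxx.
    have [->|nuz] := eqVneq u z; first by rewrite Gxx.
    by apply: (wmin u); rewrite /= uS -uB nuz zu.
  have := bmin (z, w); rewrite /= zS wS /= => bm.
  have : (#|ball x a| <= #|ball z b|)%N.
    by apply: bm; apply: (leq_trans bigz); rewrite leq_mul2l subset_leq_card.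
  rewrite leqNgt => /negP; apply; apply: proper_card; rewrite fintype.properE; apply/andP; split.
    apply/fintype.subsetP => u; rewrite !inE => /andP[-> zu] /=.
    by have := ultra x z u; rewrite /inB in zB; lra.
  apply/negP => /fintype.subsetP sub.
  have : x \in ball z b by apply: sub; rewrite inE xS Gxx; exact: Gle.
  have : y \in ball z b by apply: sub; rewrite inE yS lexx.
  rewrite !inE => /andP[_ zy] /andP[_ zx].
  by have := ultra x z y; rewrite (GC x z) -/a; lra.
have dE z w : d z w = h z + h w - 2 * G z w by rewrite /gromov; lra.
have dle z w : d z w <= delta z + delta w.
  rewrite dE /delta; have := ultra z x w; rewrite (GC z x).
  by case: (leP (G x z) a); case: (leP (G x w) a); lra.
move=> z w zS wS nezw; have dge : delta z + delta w <= d z w.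
  rewrite dE /delta; move: nezw; rewrite /e negb_and !negb_or negbK.
  have := ultra x z w; have := ultra x w z; rewrite (GC w z) /inB.
  by case: (leP a (G x z)); case: (leP a (G x w)) => //=; rewrite -?leNgt; lra.
have := dle z c; have := dle c w; have := cmin z zS; have := cmin w wS; lra.
Qed.

Lemma centroid_forests n (S : {set X}) : (#|S| <= 2 ^ n)%N ->
  exists f : nat -> X -> X, [/\ forall i x, f i (f i x) = f i x,
    forall i x, x \in S -> f i x \in S &
    forall x y, x \in S -> y \in S -> x != y ->
      exists2 i, (i < n)%N & f i x = f i y /\ d x (f i x) + d (f i x) y <= 2 * d x y].
Proof.
elim: n S => [|n IH] S hS.
  exists (fun=> id); split=> // x y xS yS nxy.
  have : (#|[set x; y]| <= #|S|)%N.
    by apply: subset_leq_card; apply/fintype.subsetP => z; rewrite !inE => /orP[] /eqP->.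
  by rewrite cards2 nxy => /leq_trans/(_ hS).
have [S2|S2] := leqP 2 #|S|; last first.
  have [|f [f1 f2 f3]] := IH S; first by have := expn_gt0 2 n; lia.
  exists f; split=> // x y xS yS nxy; have [i ni hi] := f3 x y xS yS nxy.
  by exists i => //; exact: ltnW.
have [c [e [cS eE esmall ecover]]] := centroid S2.
pose cls x := [set y in S | e x y].
have er x : e x x by case: (eE x x x).
have cls_eq x y : e x y -> cls x = cls y.
  by move=> xy; apply/setP => z; rewrite !inE; case: (eE x y z) => _ ->.
have cls_small x : x \in S -> (#|cls x| <= 2 ^ n)%N.
  by move=> /esmall; rewrite -/(cls x) expnS in hS *; lia.
pose good (C : {set X}) (f : nat -> X -> X) := (#|C| <= 2 ^ n)%N ->
    [/\ forall i x, f i (f i x) = f i x,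
      forall i x, x \in C -> f i x \in C &
      forall x y, x \in C -> y \in C -> x != y ->
        exists2 i, (i < n)%N & f i x = f i y /\ d x (f i x) + d (f i x) y <= 2 * d x y].
have ex C : exists f, good C f.
  have [/IH[f hf]|lt] := leqP #|C| (2 ^ n)%N; first by exists f.
  by exists (fun=> id); rewrite /good leqNgt lt.
have [F hF] := fin_all_exists ex; rewrite /good in hF.
pose f i x := if x \in S then (if i is j.+1 then F (cls x) j x else c) else x.
have xcls x : x \in S -> x \in cls x by move=> xS; rewrite inE xS er.
have FS j x : x \in S -> (F (cls x) j x \in S) /\ e x (F (cls x) j x).
  move=> xS; have [_ /(_ j x (xcls _ xS)) + _] := hF _ (cls_small _ xS).
  by rewrite inE => /andP.
have fS i x : x \in S -> f i x \in S.
  by rewrite /f => xS; rewrite xS; case: i => // j; case: (FS j x xS).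
exists f; split=> //.
- move=> i x; have [xS|nxS] := boolP (x \in S); last by rewrite /f (negPf nxS) (negPf nxS).
  have := fS i x xS; case: i => [|j] fxS; rewrite [LHS]/f fxS /f xS //.
  have [_ /cls_eq <-] := FS j x xS; by have [->] := hF _ (cls_small _ xS).
- move=> x y xS yS nxy; have [exy|nexy] := boolP (e x y); last first.
    by exists 0%N; rewrite // /f xS yS; split=> //; exact: ecover.
  have [_ _ /(_ x y (xcls _ xS))] := hF _ (cls_small _ xS).
  case=> [||i ni hi]; [by rewrite inE yS|by []|].
  by exists i.+1; rewrite // /f xS yS -(cls_eq _ _ exy).
Qed.

Lemma cover_2 : (2 <= #|X|)%N ->
  exists beta : nat, metric_cover 2 beta /\ beta%:R <= 2 / ln 2 * ln (#|X|%:R : R).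
Proof.
move=> X2; have [x0 _] : exists x0 : X, x0 \in X by apply/card_gt0P; exact: ltnW X2.
pose n := up_log 2 #|X|.
have [|f [ff _ hf]] := @centroid_forests n [set: X]%SET.
  by rewrite cardsT; exact: up_logP.
have n0 : (0 < n)%N by rewrite up_log_gt0.
exists n; split.
  have [F hF] := fin_all_exists (fun i : 'I_n => star_forest_tree d0 dsym dpos dtri x0 (ff i)).
  exists F; split=> [i|x y]; first by case: (hF i).
  have [<-|nxy] := eqVneq x y; first by exists (Ordinal n0); rewrite distxx d0 mulr0.
  have [|||i ni [fxy hi]] := hf x y; rewrite ?inE //.
  by exists (Ordinal ni); apply: le_trans hi; case: (hF (Ordinal ni)) => _; apply.
have l2 : 0 < ln (2 : R) by rewrite ln_gt0 // ltr1n.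
have lX : ln (2 : R) <= ln (#|X|%:R : R) by rewrite ler_ln ?posrE ?ltr0n ?ler_nat //; lia.
have : n.-1%:R * ln (2 : R) <= ln (#|X|%:R : R).
  rewrite mulr_natl -lnXn ?ltr0n // ler_ln ?posrE ?exprn_gt0 ?ltr0n //; last by lia.
  by rewrite -natrX ler_nat ltnW // up_log_gtn.
have -> : n%:R = n.-1%:R + 1 :> R by rewrite natr1 prednK.
by rewrite mulrAC ler_pdivlMr //; lra.
Qed.

Lemma cover_1 : (0 < #|X|)%N -> metric_cover 1 #|X|.
Proof.
move=> X0; have [F hF] := fin_all_exists (fun i : 'I_#|X| =>
  star_forest_tree d0 dsym dpos dtri (enum_val i) (fun x : X => erefl (enum_val i))).
exists F; split=> [i|x y]; first by case: (hF i).
exists (enum_rank x); case: (hF (enum_rank x)) => _ /(_ x y erefl).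
by rewrite enum_rankK d0 add0r mul1r.
Qed.

End RootedMetric.

Section Terminals.
Variables (R : realType) (V : finType) (T : wtree R V) (K : {set V}).
Hypothesis K2 : (2 <= #|K|)%N.
Let X := {x : V | x \in K}.
Let d (x y : X) := dist T (val x) (val y).

Lemma card_terminals : #|{: X}| = #|K|.
Proof. by rewrite card_sig; apply: eq_card => x; rewrite !inE. Qed.

Lemma terminal_metric : exists h : X -> R,
  [/\ forall x, d x x = 0, forall x y, d x y = d y x,
      forall x y, x != y -> 0 < d x y & forall x y z, d x z <= d x y + d y z] /\
  [/\ forall x y, h x <= h y + d x y, forall x y, d x y <= h x + h y &
      forall x y z, d x z + h y <= Num.max (d x y + h z) (d y z + h x)].
Proof.
have /card_gt0P[r rK] : (0 < #|K|)%N by lia.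
exists (fun x => dist T (val x) r); split; split; rewrite /d.
- by move=> x; exact: distxx.
- by move=> x y; exact: dist_sym.
- by move=> x y nxy; apply: dist_gt0; rewrite (inj_eq val_inj).
- by move=> x y z; exact: dist_triangle.
- by move=> x y; rewrite addrC dist_triangle.
- by move=> x y; rewrite [X in _ + X]dist_sym dist_triangle.
- move=> x y z; have := four_point T (val x) (val z) (val y) r.
  by rewrite (dist_sym T (val z) (val y)) [X in Num.max _ X]addrC.
Qed.

End Terminals.

(** * Lower bounds *)

Section FewHops.
Variables (R : realType) (X : finType) (F : wtree R X) (len : X -> X -> R) (L : R).
Hypothesis len_ge0 : forall x y, 0 <= len x y.
Hypothesis weight_ge : forall x y, adj F x y -> 2 * L + len x y <= weight F x y.

Lemma walk_weight_size x p : path (adj F) x p ->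
  (size p)%:R * (2 * L) <= walk_weight F x p.
Proof.
elim: p x => [|z p IH] x /=; first by rewrite mul0r.
case/andP=> /weight_ge w /IH; have := len_ge0 x z; rewrite mulrS; lra.
Qed.

Lemma one_hop x y : 0 < L -> x != y -> dist F x y < 4 * L -> adj F x y.
Proof.
move=> L0 nxy /dist_lt_walk[p [pp lp wp]].
case: p lp pp wp => [/eqP|z [|u p]] /=; first by rewrite (negPf nxy).
  by move=> -> /andP[].
move=> _ pp; have := @walk_weight_size x [:: z, u & p] pp; rewrite /= !mulrS.
have : 0 <= (size p)%:R * (2 * L) by rewrite mulr_ge0 //; lra.
lra.
Qed.

Lemma two_hops b x y : 0 < L -> x != y -> dist F x y < b -> b <= 6 * L ->
  adj F x y \/ exists c, [/\ adj F x c, adj F c y & 4 * L + len x c + len c y < b].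
Proof.
move=> L0 nxy /dist_lt_walk[p [pp lp wp]] bL.
case: p lp pp wp => [/eqP|z [|u [|v p]]] /=; first by rewrite (negPf nxy).
- by move=> -> /andP[]; left.
- move=> -> /and3P[axz azy _] w; right; exists z; split=> //.
  by have := weight_ge axz; have := weight_ge azy; lra.
move=> _ pp; have := @walk_weight_size x [:: z, u, v & p] pp; rewrite /= !mulrS.
have : 0 <= (size p)%:R * (2 * L) by rewrite mulr_ge0 //; lra.
lra.
Qed.

End FewHops.

Lemma double_counting (R : realType) (X : finType) (beta : nat) (B : R)
    (W : X -> X -> R) (A : 'I_beta -> X -> X -> R) :
  (forall x y, x != y -> W x y <= \sum_i (A i x y + A i y x)) ->
  (forall i x y, 0 <= A i x y) ->
  (forall i x, \sum_y A i x y <= B) ->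
  \sum_x \sum_(y | y != x) W x y <= 2 * beta%:R * B * #|X|%:R.
Proof.
move=> hW A0 hA.
have tot : \sum_i \sum_x \sum_y A i x y <= beta%:R * B * #|X|%:R.
  have -> : beta%:R * B * #|X|%:R = \sum_(i < beta) \sum_(x : X) B.
    by rewrite !sumr_const card_ord mulr_natl mulr_natr mulrnAC.
  by apply: ler_sum => i _; apply: ler_sum.
apply: (@le_trans _ _ (\sum_x \sum_y \sum_i (A i x y + A i y x))).
  apply: ler_sum => x _; rewrite [leRHS](bigID (fun y => y != x)) /= -[leLHS]addr0.
  apply: lerD; first by apply: ler_sum => y nyx; apply: hW; rewrite eq_sym.
  by apply: sumr_ge0 => y _; apply: sumr_ge0 => i _; rewrite addr_ge0.
have -> : \sum_x \sum_y \sum_i (A i x y + A i y x) = 2 * \sum_i \sum_x \sum_y A i x y.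
  have e : \sum_x \sum_y \sum_i A i x y = \sum_i \sum_x \sum_y A i x y.
    by under eq_bigr do rewrite exchange_big; rewrite exchange_big.
  rewrite mulr_natl mulr2n -{1}e -e [in X in _ + X]exchange_big -big_split /=.
  by apply: eq_bigr => x _; rewrite -big_split; apply: eq_bigr => y _; rewrite -big_split.
by rewrite -!mulrA ler_pM2l // mulrA.
Qed.

Definition gap (i j : nat) : nat := (i - j + (j - i))%N.

Lemma ln_step (R : realType) k :
  ln (k.+2%:R : R) <= ln (k.+1%:R : R) + k.+1%:R^-1.
Proof.
have k0 : 0 < k.+1%:R :> R by rewrite ltr0n.
have -> : k.+2%:R = k.+1%:R * (1 + k.+1%:R^-1) :> R.
  by rewrite mulrDr mulr1 divff ?gt_eqF // natr1.
have i0 : 0 < k.+1%:R^-1 :> R by rewrite invr_gt0.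
rewrite lnM ?posrE ?addr_gt0 // lerD2l le_ln1Dx //.
by apply: lt_trans i0; rewrite ltrN10.
Qed.

Lemma harmonic_left (R : realType) i :
  ln (i.+1%:R : R) <= \sum_(0 <= j < i) (gap i j)%:R^-1.
Proof.
elim: i => [|i IH]; first by rewrite big_geq // ln1.
rewrite big_nat_recl //= /gap subn0 sub0n addn0.
by apply: le_trans (ln_step R i) _; rewrite addrC lerD2l.
Qed.

Lemma harmonic_right (R : realType) i k :
  ln (k.+1%:R : R) <= \sum_(i.+1 <= j < i.+1 + k) (gap i j)%:R^-1.
Proof.
elim: k => [|k IH]; first by rewrite big_geq ?addn0 // ln1.
rewrite addnS big_nat_recr ?leq_addr //=; apply: le_trans (ln_step R k) _.
by rewrite lerD //; have -> : gap i (i.+1 + k) = k.+1 by rewrite /gap; lia.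
Qed.

Lemma harmonic_punctured (R : realType) n (i : 'I_n) :
  ln (n%:R : R) <= \sum_(j < n | j != i) (gap i j)%:R^-1.
Proof.
have skip (f : nat -> R) a b : (b <= i)%N || (i < a)%N ->
    \sum_(a <= j < b | j != i) f j = \sum_(a <= j < b) f j.
  move=> out; rewrite big_nat_cond [RHS]big_nat_cond; apply: eq_bigl => j.
  by rewrite andbT; case: eqP => [->|_]; rewrite ?andbT //=; lia.
rewrite -(big_mkord (fun j => j != i) (fun j => (gap i j)%:R^-1)).
have lt := ltn_ord i; rewrite (@big_cat_nat _ _ _ i) //=; last exact: ltnW.
rewrite (@big_ltn_cond _ _ _ i) // eqxx /= !skip ?leqnn ?orbT //.
have hr := harmonic_right R i (n - i.+1); rewrite subnKC // in hr.
apply: le_trans (lerD (harmonic_left R i) hr).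
rewrite -lnM ?posrE ?ltr0n // -natrM ler_ln ?posrE ?ltr0n ?ler_nat ?muln_gt0 //; last by lia.
by rewrite (_ : n - i.+1 = n - i - 1)%N; nia.
Qed.

Lemma gap_eq0 i j : (gap i j == 0)%N = (i == j).
Proof. by rewrite /gap; lia. Qed.

Lemma gapC i j : gap i j = gap j i.
Proof. by rewrite /gap addnC. Qed.

Lemma gap_triangle k i j : (gap i j <= gap i k + gap k j)%N.
Proof. by rewrite /gap; lia. Qed.

Lemma nearby_center (a b e : nat) :
  (b <= a)%N -> (a <= e + b)%N -> (a + b <= 2 * e)%N -> (e <= a + b)%N ->
  (e <= 2 * a)%N && (2 * a <= 3 * e)%N.
Proof. lia. Qed.

(* A path of unit edges with a leaf hanging off each vertex by an edge of weight [L]. *)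
Lemma caterpillar (R : realType) (m : nat) (L : R) : 0 < L ->
  exists T : wtree R ('I_m.+1 * bool)%type, forall i j, i != j ->
    dist T (i, true) (j, true) = 2 * L + (gap i j)%:R.
Proof.
move=> L0; pose V := ('I_m.+1 * bool)%type.
pose len (u v : V) : R := L * (u.2 + v.2)%:R + (gap u.1 v.1)%:R.
pose d u v := if u == v then 0 else len u v.
have len_ge0 u v : 0 <= len u v by rewrite addr_ge0 // mulr_ge0 // ltW.
have dd u : d u u = 0 by rewrite /d eqxx.
have dsym u v : d u v = d v u.
  by rewrite /d eq_sym /len addnC gapC.
have dpos u v : u != v -> 0 < d u v.
  case: u v => i a [j b]; rewrite /d => nuv; rewrite (negPf nuv) /len /=.
  have [ij|nij] := eqVneq i j; last first.
    by rewrite ltr_wpDl // ?mulr_ge0 ?(ltW L0) // ltr0n lt0n gap_eq0.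
  rewrite ltr_pwDl // mulr_gt0 // ltr0n.
  by move: nuv; rewrite ij xpair_eqE eqxx; case: a; case: b.
have dtri u v w : d u w <= d u v + d v w.
  rewrite /d; have [->|nuw] := eqVneq u w.
    by apply: addr_ge0; case: ifP.
  have [<-|nuv] := eqVneq u v; first by rewrite (negPf nuw) add0r lexx.
  have [->|nvw] := eqVneq v w; first by rewrite addr0 lexx.
  have : (gap u.1 w.1)%:R <= (gap u.1 v.1)%:R + (gap v.1 w.1)%:R :> R.
    by rewrite -natrD ler_nat gap_triangle.
  have : 0 <= L * (v.2 : nat)%:R by rewrite mulr_ge0 // ltW.
  by rewrite /len !natrD !mulrDr; lra.
pose p (u : V) : V := if u.2 then (u.1, false) else (inord u.1.-1, false).
pose rk (u : V) := if u.2 then 0%N else (m.+1 - u.1)%N.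
have inordE (i : 'I_m.+1) : (inord i.-1 : 'I_m.+1) = i.-1 :> nat.
  by apply: inordK; exact: leq_ltn_trans (leq_pred i) (ltn_ord i).
have [|T [dom hT]] := @parent_tree R V d dd dsym dpos dtri p rk (ord0, false).
  case=> i [] nr; rewrite /rk /p /=; have lt := ltn_ord i; first by rewrite subn_gt0.
  rewrite inordE; have : i != 0 :> nat.
    by apply: contra nr => /eqP i0; apply/eqP; congr (_, _); exact: val_inj.
  lia.
have spine k (i j : 'I_m.+1) : i = (j + k)%N :> nat -> dist T (i, false) (j, false) <= k%:R.
  elim: k i => [|k IH] i e.
    have -> : i = j by apply: val_inj; rewrite /= e addn0.
    by rewrite distxx.
  pose i1 : 'I_m.+1 := inord i.-1; have e1 : i1 = (j + k)%N :> nat by rewrite /i1 inordE e addnS.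
  have := hT (i, false); rewrite /p /= -/i1 xpair_eqE eqxx andbT -val_eqE /= e addnS => /(_ isT).
  rewrite /d xpair_eqE eqxx andbT -val_eqE /= e1 e addnS gtn_eqF // /len /= mulr0 add0r e1 e.
  have -> : gap (j + k.+1) (j + k) = 1%N by rewrite /gap; lia.
  have := dist_triangle T (i1, false) (i, false) (j, false); have := IH _ e1.
  by rewrite -natr1; lra.
have spine' (i j : 'I_m.+1) : dist T (i, false) (j, false) <= (gap i j)%:R.
  have [le|lt] := leqP j i; first by apply: spine; rewrite /gap; lia.
  by rewrite dist_sym; apply: spine; rewrite /gap; lia.
have leg i : dist T (i, true) (i, false) <= L.
  have nr : (i, true) != (ord0, false) :> V by rewrite xpair_eqE andbF.
  have := hT _ nr; rewrite /p /= => /le_trans; apply.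
  rewrite /d xpair_eqE andbF /len /=.
  by rewrite addn0 mulr1 (_ : gap i i = 0%N) ?addr0 // /gap subnn.
exists T => i j nij; apply/eqP; rewrite eq_le; apply/andP; split.
  have := dist_triangle T (i, false) (i, true) (j, true).
  have := dist_triangle T (j, false) (i, false) (j, true).
  have := leg i; have := leg j; have := spine' i j; rewrite (dist_sym T (j, true)); lra.
have := dom (i, true) (j, true); rewrite /d xpair_eqE (negPf nij) /len /=.
by rewrite (_ : true + true = 2)%N // mulrC.
Qed.

Definition leaves (m : nat) : {set 'I_m.+1 * bool} := [set u | u.2]%SET.

Section CaterpillarCovers.
Variables (R : realType) (m : nat) (L : R) (T : wtree R ('I_m.+1 * bool)%type).
Hypothesis L0 : 0 < L.
Hypothesis hT : forall i j, i != j -> dist T (i, true) (j, true) = 2 * L + (gap i j)%:R.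
Local Notation K := (leaves m).
Let X := {u : 'I_m.+1 * bool | u \in K}.
Let pos (x : X) : 'I_m.+1 := (val x).1.
Let g (x y : X) : nat := gap (pos x) (pos y).

Lemma leafP i : (i, true) \in K.
Proof. by rewrite /leaves inE. Qed.

Let leaf i : X := Sub (i, true) (leafP i).

Lemma posK : cancel pos leaf.
Proof.
move=> x; apply: val_inj; have := valP x; rewrite /leaves inE SubK /pos.
by case: (val x) => i b /= ->.
Qed.

Lemma leafK : cancel leaf pos. Proof. by []. Qed.

Lemma card_leaves : #|K| = m.+1.
Proof.
rewrite -card_terminals -[RHS]card_ord.
exact: (bij_eq_card (Bijective posK leafK)).
Qed.

Lemma leaf_dist x y : x != y -> dist T (val x) (val y) = 2 * L + (g x y)%:R.
Proof.
move=> nxy; rewrite -(posK x) -(posK y) /= hT //.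
by rewrite (inj_eq (can_inj posK)).
Qed.

Lemma leaf_weight (F : wtree R X) :
  (forall x y, dist T (val x) (val y) <= dist F x y) ->
  forall x y, adj F x y -> 2 * L + (g x y)%:R <= weight F x y.
Proof.
move=> dom x y a; rewrite -leaf_dist; last by apply: contraTneq a => ->; rewrite adj_irr.
exact: le_trans (dom x y) (dist_adj a).
Qed.

Lemma g_gt0 x y : x != y -> (0 < g x y)%N.
Proof. by move=> nxy; rewrite lt0n gap_eq0 (inj_eq val_inj) (inj_eq (can_inj posK)). Qed.

Lemma g_lt x y : (g x y < m.+1)%N.
Proof. by have := ltn_ord (pos x); have := ltn_ord (pos y); rewrite /g /gap; lia. Qed.

Lemma sum_indicator (a : X) : \sum_y (a == y)%:R = 1 :> R.
Proof.
rewrite (bigD1 a) //= eqxx big1 ?addr0 // => y nya.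
by rewrite eq_sym (negPf nya).
Qed.

Lemma cover_lt2_lower (eps : R) (beta : nat) : 0 < eps < 1 -> m.+1%:R <= eps * L ->
  has_cover T K (2 - eps) beta -> m%:R <= 2 * beta%:R :> R.
Proof.
move=> /andP[e0 e1] hL [F [dom low]].
have ex i : exists p : X -> X, forall x y, adj (F i) x y -> p x = y \/ p y = x.
  by have [rk [p [_ [_ hp]]]] := exists_parent (F i); exists p.
have [p hp] := fin_all_exists ex.
have := @double_counting R X beta 1 (fun _ _ => 1) (fun i x y => (p i x == y)%:R) _ _ _.
have -> : \sum_(x : X) \sum_(y | y != x) (1 : R) = m%:R * m.+1%:R.
  rewrite (eq_bigr (fun=> m%:R)) => [|x _].
    by rewrite sumr_const card_terminals card_leaves mulr_natr.
  by rewrite sumr_const (@eq_card _ _ (predC1 x)) // cardC1 card_terminals card_leaves.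
rewrite mulr1 card_terminals card_leaves ler_pM2r ?ltr0n //; apply.
- move=> x y nxy; have [i hi] := low x y.
  have a : adj (F i) x y.
    apply: (one_hop _ (leaf_weight (dom i))) => //.
    apply: (le_lt_trans hi); rewrite leaf_dist //.
    have : (g x y)%:R < m.+1%:R :> R by rewrite ltr_nat g_lt.
    have : 0 <= eps * (g x y)%:R by rewrite mulr_ge0 // ltW.
    lra.
  rewrite (bigD1 i) //= -[leLHS]addr0 lerD //; last first.
    by apply: sumr_ge0 => j _; rewrite addr_ge0.
  by case: (hp i x y a) => ->; rewrite eqxx ?lerDl ?lerDr.
- by move=> i x y; exact: ler0n.
- by move=> i x; rewrite sum_indicator.
Qed.

Lemma near_card (x : X) r :
  (#|[pred y | (y != x) && (g x y <= 2 * r)%N]| <= 4 * r)%N.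
Proof.
set A := [pred y | _]; pose s := map (fun y => val (pos y)) (enum A).
have -> : #|A| = size s by rewrite size_map cardE.
pose i := val (pos x); pose t := iota (i - 2 * r) (2 * r) ++ iota i.+1 (2 * r).
have -> : (4 * r = size t)%N by rewrite size_cat !size_iota; lia.
apply: uniq_leq_size.
  by rewrite map_inj_uniq ?enum_uniq // => y z /val_inj/(can_inj posK).
move=> v /mapP[y + ->]; rewrite mem_enum => /andP[nyx gy].
rewrite mem_cat !mem_iota -/i; move: gy.
have : (val (pos y) != i)%N by rewrite (inj_eq val_inj) (inj_eq (can_inj posK)).
by rewrite /g /gap -/i /=; lia.
Qed.

Lemma near_sum (x : X) r :
  \sum_(y | [&& y != x, g x y <= 2 * r & 2 * r <= 3 * g x y]%N) (g x y)%:R^-1 <= 6 :> R.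
Proof.
have [->|r0] := posnP r.
  rewrite big1 // => y /and3P[nyx]; rewrite leqn0 => /eqP ->; by rewrite invr0.
have r0' : 0 < r%:R :> R by rewrite ltr0n.
apply: (@le_trans _ _ (\sum_(y | (y != x) && (g x y <= 2 * r)%N) (3 / (2 * r%:R)))).
  rewrite big_mkcond [leRHS]big_mkcond; apply: ler_sum => y _.
  case: ifP => [/and3P[nyx near h]|_]; last by case: ifP => // _; rewrite divr_ge0 ?mulr_ge0.
  rewrite nyx near /=.
  have g0 : 0 < (g x y)%:R :> R by rewrite ltr0n g_gt0 // eq_sym.
  rewrite ler_pdivlMr ?mulr_gt0 // mulrC ler_pdivrMr //.
  by rewrite -!natrM ler_nat.
rewrite sumr_const -[leLHS]mulr_natl.
apply: (@le_trans _ _ ((4 * r)%:R * (3 / (2 * r%:R)))).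
  by rewrite ler_wpM2r ?divr_ge0 ?mulr_ge0 // ler_nat near_card.
suff -> : (4 * r)%:R * (3 / (2 * r%:R)) = 6 :> R by [].
by rewrite natrM; field; rewrite gt_eqF.
Qed.

Lemma cover_2_lower (beta : nat) : L = m.+1%:R ->
  has_cover T K 2 beta -> ln (m.+1%:R : R) <= 16 * beta%:R.
Proof.
move=> hL [F [dom low]].
have ex i : exists p : X -> X, forall x y, adj (F i) x y -> p x = y \/ p y = x.
  by have [rk [p [_ [_ hp]]]] := exists_parent (F i); exists p.
have [p hp] := fin_all_exists ex.
pose near i x y := [&& y != x, g x y <= 2 * g x (p i x) & 2 * g x (p i x) <= 3 * g x y]%N.
pose A i x y : R := (p i x == y)%:R + (p i (p i x) == y)%:R
  + (if near i x y then (g x y)%:R^-1 else 0).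
have gC x y : g x y = g y x by exact: gapC.
have N0 i x y : 0 <= (if near i x y then (g x y)%:R^-1 else 0 : R).
  by case: ifP => _; rewrite ?invr_ge0 ?ler0n.
have A0 i x y : 0 <= A i x y by rewrite !addr_ge0.
have A_parent i x y : p i x = y -> 1 <= A i x y.
  by move=> <-; rewrite /A eqxx -addrA lerDl addr_ge0.
have A_grandparent i x y : p i (p i x) = y -> 1 <= A i x y.
  by move=> <-; rewrite /A eqxx addrAC lerDr addr_ge0.
have A_near i x y : near i x y -> (g x y)%:R^-1 <= A i x y.
  by rewrite /A => ->; rewrite lerDr addr_ge0.
have A8 i x : \sum_y A i x y <= 8.
  rewrite !big_split /= !sum_indicator -big_mkcond /=.
  by have := near_sum x (g x (p i x)); rewrite /near; lra.
have W x y : x != y -> (g x y)%:R^-1 <= \sum_i (A i x y + A i y x).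
  move=> nxy; have [i hi] := low x y.
  rewrite (bigD1 i) //= -[leLHS]addr0 lerD //; last first.
    by apply: sumr_ge0 => j _; rewrite addr_ge0.
  have g1 : 1 <= (g x y)%:R :> R by rewrite ler1n g_gt0.
  have w1 : (g x y)%:R^-1 <= 1 :> R by rewrite invf_le1 // (lt_le_trans ltr01).
  have ltL : (g x y)%:R + 1 <= L by rewrite hL natr1 ler_nat g_lt.
  have lt : dist (F i) x y < 4 * L + 2 * (g x y)%:R + 1.
    by apply: le_lt_trans hi _; rewrite leaf_dist //; lra.
  have b6 : 4 * L + 2 * (g x y)%:R + 1 <= 6 * L by lra.
  have [|/(hp i)|[c [/(hp i) xc /(hp i) cy hc]]] := two_hops _ (leaf_weight (dom i)) L0 nxy lt b6.
  - by [].
  - case=> /A_parent h; apply: le_trans w1 _; apply: le_trans h _.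
      by rewrite lerDl.
    by rewrite lerDr.
  have {}hc : (g x c + g c y <= 2 * g x y)%N.
    have : (g x c + g c y)%:R < (2 * g x y)%:R + 1 :> R by rewrite natrD natrM; lra.
    by rewrite natr1 ltr_nat.
  have t1 : (g x c <= g x y + g c y)%N by rewrite (gC c y); exact: gap_triangle.
  have t2 : (g c y <= g x y + g x c)%N by rewrite addnC (gC x c); exact: gap_triangle.
  have t3 : (g x y <= g x c + g c y)%N by exact: gap_triangle.
  case: xc cy => [px|pc] [pc'|py].
  - apply: le_trans w1 _; apply: (le_trans (A_grandparent i x y _)); first by rewrite px.
    by rewrite lerDl.
  - have [le|lt'] := leqP (g c y) (g x c).
      have nr : near i x y by rewrite /near px eq_sym nxy; exact: nearby_center t3.
      by apply: le_trans (A_near _ _ _ nr) _; rewrite lerDl.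
    have nr : near i y x.
      rewrite /near py nxy (gC y c) (gC y x).
      by apply: nearby_center (ltnW lt') t2 _ _; rewrite addnC.
    by rewrite gC; apply: le_trans (A_near _ _ _ nr) _; rewrite lerDr.
  - by rewrite -pc -pc' eqxx in nxy.
  - apply: le_trans w1 _; apply: (le_trans (A_grandparent i y x _)); first by rewrite py.
    by rewrite lerDr.
have := double_counting W A0 A8; rewrite card_terminals card_leaves => tot.
have : ln (m.+1%:R : R) * m.+1%:R <= 2 * beta%:R * 8 * m.+1%:R.
  apply: le_trans tot; rewrite mulr_natr -[X in _ *+ X]card_leaves -card_terminals.
  rewrite -sumr_const; apply: ler_sum => x _.
  apply: le_trans (harmonic_punctured R (pos x)) _.
  rewrite (reindex pos) /=; last by apply: onW_bij; exact: (Bijective posK leafK).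
  rewrite le_eqVlt; apply/orP; left; apply/eqP; apply: eq_bigl => y.
  by rewrite (inj_eq (can_inj posK)).
by rewrite ler_pM2r ?ltr0n //; lra.
Qed.

End CaterpillarCovers.

Theorem theorem1p5 (R : realType) :
  (* (1) *)
  (exists C : R, forall eps : R, 0 < eps < 1 ->
     forall (V : finType) (T : wtree R V) (K : {set V}), (2 <= #|K|)%N ->
     exists beta : nat, has_cover T K (2 + eps) beta /\
       beta%:R <= C * (eps ^- 2 * Num.max 1 (ln eps^-1)))
  /\
  (* (2) *)
  ((exists C : R,
     forall (V : finType) (T : wtree R V) (K : {set V}), (2 <= #|K|)%N ->
     exists beta : nat, has_cover T K 2 beta /\
       beta%:R <= C * ln #|K|%:R)
   /\
   (exists c : R, 0 < c /\ forall n : nat, (2 <= n)%N ->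
     exists (V : finType) (T : wtree R V) (K : {set V}), #|K| = n /\
       forall beta : nat, has_cover T K 2 beta -> c * ln n%:R <= beta%:R))
  /\
  (* (3) *)
  ((exists C : R, forall eps : R, 0 < eps < 1 ->
     forall (V : finType) (T : wtree R V) (K : {set V}), (2 <= #|K|)%N ->
     exists beta : nat, has_cover T K (2 - eps) beta /\
       beta%:R <= C * #|K|%:R)
   /\
   (exists c : R, 0 < c /\ forall eps : R, 0 < eps < 1 ->
     forall n : nat, (2 <= n)%N ->
     exists (V : finType) (T : wtree R V) (K : {set V}), #|K| = n /\
       forall beta : nat, has_cover T K (2 - eps) beta -> c * n%:R <= beta%:R)).
Proof.
split; [|split; split].
- exists 2752 => eps eps01 V T K K2.
  have [h [[d0 dsym dpos dtri] [hlip hsum dfour]]] := terminal_metric T K2.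
  have [x0 _] : exists x0 : {x | x \in K}, x0 \in {: {x | x \in K}}.
    by apply/card_gt0P; rewrite card_terminals ltnW.
  have [beta [cov le]] := cover_2_plus d0 dsym dpos dtri hlip hsum dfour x0 eps01.
  exists beta; split; first exact: cov.
  have e0 : 0 <= eps ^- 2 by rewrite invr_ge0 sqr_ge0.
  by apply: (le_trans le); rewrite ler_pM2l // ler_peMr // le_max lexx.
- exists (2 / ln 2) => V T K K2.
  have [h [[d0 dsym dpos dtri] [hlip hsum dfour]]] := terminal_metric T K2.
  have := cover_2 d0 dsym dpos dtri hlip dfour.
  by rewrite card_terminals => /(_ K2).
- exists 16^-1; split=> [|[//|m] _]; first by rewrite invr_gt0.
  have L0 : 0 < m.+1%:R :> R by rewrite ltr0n.
  have [T hT] := caterpillar m L0.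
  exists _, T, (leaves m); split; first exact: card_leaves.
  move=> beta /(cover_2_lower L0 hT erefl); rewrite ler_pdivrMl //.
- exists 1 => eps /andP[_ eps1] V T K K2.
  have [h [[d0 dsym dpos dtri] _]] := terminal_metric T K2.
  exists #|K|; rewrite mul1r lexx; split=> //.
  have := cover_1 d0 dsym dpos dtri; rewrite card_terminals => /(_ (ltnW K2))[F [dom low]].
  exists F; split=> // x y; have [i hi] := low x y; exists i; apply: le_trans hi _.
  by rewrite ler_wpM2r ?dist_ge0 //; lra.
- exists 4^-1; split=> [|eps eps01 [//|m] m1]; first by rewrite invr_gt0.
  have e0 : 0 < eps by case/andP: eps01.
  have L0 : 0 < m.+1%:R / eps :> R by rewrite divr_gt0.
  have [T hT] := caterpillar m L0.
  exists _, T, (leaves m); split; first exact: card_leaves.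
  have hL : m.+1%:R <= eps * (m.+1%:R / eps) by rewrite mulrC divfK // gt_eqF.
  move=> beta /(cover_lt2_lower L0 hT eps01 hL) le.
  have : m.+1%:R <= 2 * m%:R :> R by rewrite -natrM ler_nat; lia.
  by rewrite ler_pdivrMl //; lra.
Qed.
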